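(* Let $(X,\mathcal{X},\mu,T)$ be a measure preserving system that has a Lebesgue spectral measure realized by a bounded function, that is, there exists $g\in L^\infty(\mu)$ with $\|g\|_{L^2(\mu)}=1$ and $\int g\cdot T^ng\,d\mu=0$ for every $n\in\mathbb{N}$. Then the system has a strictly under-recurrent function with values in $[0,1]$ and a strictly over-recurrent function with values in $[0,1]$.
   Context: A measure preserving system is a quadruple $(X,\mathcal{X},\mu,T)$ where $(X,\mathcal{X},\mu)$ is a probability space and $T\colon X\to X$ is a measure preserving transformation. All functions are real valued and $T^nf$ denotes $f\circ T^n$. $\mathbb{N}=\{1,2,\ldots\}$. A function $f\in L^2(\mu)$ is strictly under-recurrent (respectively strictly over-recurrent) if it is non-constant (modulo $\mu$-null sets) and $\int f\cdot T^nf\,d\mu<\left(\int f\,d\mu\right)^2$ (respectively $>$) for every $n\in\mathbb{N}$. *)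

(* Defs.v *)
From HB Require Import structures.
From mathcomp Require Import all_boot all_order all_algebra.
From mathcomp Require Import all_classical all_reals all_analysis.

Set Implicit Arguments.
Unset Strict Implicit.
Unset Printing Implicit Defensive.
Import Order.TTheory GRing.Theory Num.Theory.
Import numFieldNormedType.Exports.

Local Open Scope classical_set_scope.
Local Open Scope ring_scope.

(* No invertibility of T is required. *)
Definition measure_preserving (d : measure_display) (X : measurableType d)
    (R : realType) (mu : probability X R) (T : X -> X) : Prop :=
  measurable_fun [set: X] T /\
  forall A : set X, measurable A -> mu (T @^-1` A) = mu A.

Definition koopman (X Y : Type) (T : X -> X) (n : nat) (f : X -> Y) : X -> Y :=
  f \o iter n T.

Definition autocorrelation (d : measure_display) (X : measurableType d)
    (R : realType) (mu : probability X R) (T : X -> X) (f : X -> R) (n : nat)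
    : R :=
  (\int[mu]_x (f x * koopman T n f x))%R.

Definition ae_constant (d : measure_display) (X : measurableType d)
    (R : realType) (mu : probability X R) (f : X -> R) : Prop :=
  exists c : R, {ae mu, forall x, f x = c}.

Definition strictly_under_recurrent (d : measure_display)
    (X : measurableType d) (R : realType) (mu : probability X R) (T : X -> X)
    (f : X -> R) : Prop :=
  [/\ f \in Lfun mu 2%:E,
      ~ ae_constant mu f
    & forall n : nat, (0 < n)%N ->
        autocorrelation mu T f n < (\int[mu]_x f x)%R ^+ 2].

Definition strictly_over_recurrent (d : measure_display)
    (X : measurableType d) (R : realType) (mu : probability X R) (T : X -> X)
    (f : X -> R) : Prop :=
  [/\ f \in Lfun mu 2%:E,
      ~ ae_constant mu f
    & forall n : nat, (0 < n)%N ->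
        autocorrelation mu T f n > (\int[mu]_x f x)%R ^+ 2].

(* Orthonormality of the forward orbit of g amounts to g having Lebesgue
   spectral measure. *)
Definition bounded_Lebesgue_spectral_measure (d : measure_display)
    (X : measurableType d) (R : realType) (mu : probability X R) (T : X -> X)
    : Prop :=
  exists g : X -> R,
    [/\ g \in Lfun mu +oo%E,
        Lnorm mu 2%:E (EFin \o g) = 1%E
      & forall n : nat, (0 < n)%N -> autocorrelation mu T g n = 0].

(* Main.v *)
Require Import Defs.
From HB Require Import structures.
From mathcomp Require Import all_boot all_order all_algebra.
From mathcomp Require Import all_classical all_reals all_analysis.
From mathcomp Require Import measurable_realfun ring lra.

Set Implicit Arguments.
Unset Strict Implicit.
Unset Printing Implicit Defensive.
Import Order.TTheory GRing.Theory Num.Theory.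
Import numFieldNormedType.Exports.

Local Open Scope classical_set_scope.
Local Open Scope ring_scope.

(* Truncate g to an everywhere bounded function, write [T f] for [f \o T], and let
   phi_r be the sum of the [r^k T^k g]; it solves [phi_r = g + r (T phi_r)].  From
   this equation and the orthonormality of the orbit of g one reads off, for n > 0,
   [<g, T^n phi_r> = 0], [<phi_r, T^n g> = r^n] and
   [<phi_r, T^n phi_r> = r^n / (1 - r^2)].  The latter is positive, while for
   r = 1/2 the autocorrelations of [phi_r - 2 g] are [(4/3 - 2) / 2^n < 0].  Both
   functions are bounded with mean zero, so an affine rescaling sends them to
   [0,1]. *)

(** The bound holds at every point, not just almost everywhere, so that it survives composition with
    [T] and makes orbit series converge at each point. *)
Definition bounded_measurable {d : measure_display} {X : measurableType d}
    {R : realType} (f : X -> R) : Prop :=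
  measurable_fun [set: X] f /\ exists M : R, forall x, `|f x| <= M.

(** * Bounded measurable functions: closure, geometric sums along orbits, truncation *)

Section bounded_measurable.
Context {d : measure_display} {X : measurableType d} {R : realType}.
Implicit Types f g : X -> R.

Lemma bounded_measurable_cst (c : R) : bounded_measurable (fun _ : X => c).
Proof. by split; [exact: measurable_cst | exists `|c|]. Qed.

Lemma bounded_measurableD f g : bounded_measurable f -> bounded_measurable g ->
  bounded_measurable (fun x => f x + g x).
Proof.
move=> [mf [M fM]] [mg [N gN]]; split; first exact: measurable_funD.
by exists (M + N) => x; rewrite (le_trans (ler_normD _ _))// lerD.
Qed.

Lemma bounded_measurableM f g : bounded_measurable f -> bounded_measurable g ->
  bounded_measurable (fun x => f x * g x).
Proof.
move=> [mf [M fM]] [mg [N gN]]; split; first exact: measurable_funM.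
by exists (M * N) => x; rewrite normrM ler_pM.
Qed.

Lemma bounded_measurableZ (c : R) f : bounded_measurable f ->
  bounded_measurable (fun x => c * f x).
Proof. exact/bounded_measurableM/bounded_measurable_cst. Qed.

Lemma bounded_measurable_comp (T : X -> X) f : measurable_fun [set: X] T ->
  bounded_measurable f -> bounded_measurable (f \o T).
Proof.
move=> mT [mf [M fM]]; split; first exact: measurableT_comp.
by exists M => x; exact: fM.
Qed.

(** The terms [r ^+ k * g (iter k T x)] are dominated by [M * r ^+ k], so the series converges
    absolutely at every point, with a bound independent of the point. *)
Lemma bounded_measurable_geometric (T : X -> X) (r : R) g :
  measurable_fun [set: X] T -> 0 < r < 1 -> bounded_measurable g ->
  exists phi, bounded_measurable phi /\ forall x, phi x = g x + r * phi (T x).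
Proof.
move=> mT /andP[r0 r1] [mg [M gM]].
pose u x : R^nat := fun k => r ^+ k * g (iter k T x).
have r_lt1 : `|r| < 1 by rewrite gtr0_norm.
have nu x k : `|u x k| <= geometric M r k.
  by rewrite /u normrM normrX gtr0_norm//= mulrC ler_wpM2r// exprn_ge0// ltW.
have cnu x : cvgn [normed series (u x)].
  apply: (series_le_cvg _ _ (nu x) (is_cvg_geometric_series r_lt1)) => n //.
  exact: le_trans (nu x n).
have cu x : series (u x) @ \oo --> limn (series (u x)).
  exact/(@normed_cvg _ R^o)/cnu.
have miter k : measurable_fun [set: X] (iter k T).
  by elim: k => [|k IH]; [exact: measurable_id | exact: measurableT_comp].
exists (fun x => limn (series (u x))); split; [split|].
- apply: (@measurable_fun_cvg _ _ _ _ (fun n x => series (u x) n)) => [m|x _].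
    apply: measurable_sum => k; apply: measurable_funM => //.
    exact: measurableT_comp.
  exact: cu.
- exists (limn (series (geometric M r))) => x.
  apply: le_trans (@lim_series_norm _ R^o _ (cnu x)) _.
  exact: lim_series_le (cnu x) (is_cvg_geometric_series r_lt1) (nu x).
(* The partial sum of [n.+1] terms at [x] is [g x] plus [r] times the partial sum of [n] terms at
   [T x]; pass to the limit. *)
- move=> x; apply: cvg_lim => //; rewrite -cvg_shiftS/=.
  under eq_fun => n do rewrite /series /= big_nat_recl// {1}/u /= expr0 mul1r.
  rewrite (_ : (fun n => _) = (fun n => g x + r * series (u (T x)) n)); last first.
    apply/funext => n; congr (_ + _); rewrite /series/= mulr_sumr.
    by apply: eq_bigr => i _; rewrite /u exprS -iterSr mulrA.
  by apply: cvgD; [exact: cvg_cst | apply: cvgZr; exact: cu].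
Qed.

Lemma essentially_bounded_clip (mu : probability X R) g : g \in Lfun mu +oo%E ->
  exists h, bounded_measurable h /\ {ae mu, forall x, g x = h x}.
Proof.
rewrite inE => /andP[]; rewrite !inE /= => mg.
rewrite /finLfun /= /finite_norm unlock.
have -> : (0 < mu [set: X])%E by rewrite probability_setT.
move=> /(@ess_sup_inf.ess_supr_bounded _ _ _ mu (fun x => `|g x|)) [M gM].
(* Clipping at [|M|] rather than [M] gives a proper interval whatever the sign of [M]. *)
exists (fun x => Num.max (- `|M|) (Num.min (g x) `|M|)); split; [split|].
- apply: measurable_maxr; first exact: measurable_cst.
  by apply: measurable_minr => //; exact: measurable_cst.
- exists `|M| => x; rewrite ler_norml le_max lexx/= ge_max ge_min lexx orbT andbT.
  by rewrite (le_trans _ (normr_ge0 M))// oppr_le0.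
- apply: filterS gM => x /= gxM.
  have : `|g x| <= `|M| by rewrite (le_trans gxM)// ler_norm.
  by rewrite ler_norml => /andP[? ?]; rewrite min_l// max_r.
Qed.

End bounded_measurable.

(** * Integrals and inner products of bounded functions *)

Section inner_product.
Context {d : measure_display} {X : measurableType d} {R : realType}.
Variable mu : probability X R.
Implicit Types f g h : X -> R.

Lemma bounded_measurable_integrable f : bounded_measurable f ->
  mu.-integrable [set: X] (EFin \o f).
Proof.
move=> [mf [M fM]]; apply: measurable_bounded_integrable => //.
  by rewrite ltey_eq fin_num_measure.
by exists M; split; [exact: num_real | move=> N MN x _; exact: le_trans (fM x) (ltW MN)].
Qed.

Lemma bounded_measurable_Lfun2 f : bounded_measurable f -> f \in Lfun mu 2%:E.
Proof.
move=> [mf [M fM]].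
have mu_fin : mu [set: X] \is a fin_num by exact: fin_num_measure.
apply: (Lfun_subset (q := +oo%E) _ _ mu_fin) => [|||]; rewrite ?leey ?lee_fin ?ler1n //.
rewrite inE; apply/andP; split; rewrite inE//=.
rewrite /finite_norm unlock.
have -> : (0 < mu [set: X])%E by rewrite probability_setT.
apply: (@le_lt_trans _ _ M%:E); last exact: ltry.
by apply/ess_sup_inf.ess_supP; apply: nearW => x; rewrite lee_fin.
Qed.

Lemma Rintegral_affine (c : R) f g : bounded_measurable f -> bounded_measurable g ->
  (\int[mu]_x (f x + c * g x) = \int[mu]_x f x + c * \int[mu]_x g x)%R.
Proof.
move=> bf bg; rewrite RintegralD//.
- by rewrite RintegralZl//; exact: bounded_measurable_integrable.
- exact: bounded_measurable_integrable.
- exact/bounded_measurable_integrable/bounded_measurableZ.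
Qed.

Lemma Rintegral_probability_cst (c : R) : (\int[mu]_(x in [set: X]) c = c)%R.
Proof. by rewrite Rintegral_cst// [X in fine X](_ : _ = 1%E) ?mulr1//; exact: probability_setT. Qed.

Lemma norm_Rintegral_le (M : R) f : bounded_measurable f ->
  (forall x, `|f x| <= M) -> `|(\int[mu]_x f x)%R| <= M.
Proof.
move=> bf fM; have := le_normr_Rintegral measurableT (bounded_measurable_integrable bf).
move=> /le_trans; apply.
rewrite -[leRHS]Rintegral_probability_cst; apply: le_Rintegral => //.
  apply: bounded_measurable_integrable; case: bf => mf [N fN].
  split; first exact: measurableT_comp.
  by exists N => x; rewrite normr_id.
exact/bounded_measurable_integrable/bounded_measurable_cst.
Qed.

(** Nonnegativity of the variance. *)
Lemma sqr_Rintegral_le f : bounded_measurable f ->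
  (\int[mu]_x f x)%R ^+ 2 <= (\int[mu]_x (f x * f x))%R.
Proof.
move=> bf; set m := (\int[mu]_x f x)%R.
(* The expansion of [(f x - m) ^+ 2], nested so that [Rintegral_affine] applies twice. *)
have : 0 <= (\int[mu]_x (f x * f x + 1 * (m ^+ 2 + (- 2 * m) * f x)))%R.
  by apply: Rintegral_ge0 => x _; rewrite (_ : _ + _ = (f x - m) ^+ 2) ?sqr_ge0//; ring.
have bm2 := bounded_measurable_cst (X := X) (m ^+ 2).
rewrite Rintegral_affine; last 2 first.
- exact: bounded_measurableM.
- exact/bounded_measurableD/bounded_measurableZ.
rewrite Rintegral_affine// Rintegral_probability_cst -/m.
by nra.
Qed.

Lemma ae_eq_Rintegral f g : measurable_fun [set: X] f -> measurable_fun [set: X] g ->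
  {ae mu, forall x, f x = g x} -> (\int[mu]_x f x = \int[mu]_x g x)%R.
Proof.
move=> mf mg fg; congr fine; apply: ae_eq_integral => //.
- exact/measurable_EFinP.
- exact/measurable_EFinP.
- by apply: filterS fg => x /= -> _.
Qed.

(** By unfolding, [autocorrelation mu T f n] is [inner f (koopman T n f)]; time 0 gives the squared
    norm. *)
Definition inner f g : R := (\int[mu]_x (f x * g x))%R.

Lemma innerC f g : inner f g = inner g f.
Proof. by apply: eq_Rintegral => x _; rewrite mulrC. Qed.

Lemma inner_affinel (c : R) f g h : bounded_measurable f -> bounded_measurable g ->
  bounded_measurable h ->
  inner (fun x => f x + c * g x) h = inner f h + c * inner g h.
Proof.
move=> bf bg bh; rewrite /inner -Rintegral_affine; try exact: bounded_measurableM.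
by apply: eq_Rintegral => x _; ring.
Qed.

Lemma inner_affiner (c : R) f g h : bounded_measurable f -> bounded_measurable g ->
  bounded_measurable h ->
  inner h (fun x => f x + c * g x) = inner h f + c * inner h g.
Proof. by move=> *; rewrite innerC inner_affinel// !(innerC h). Qed.

(** * Invariance under a measure preserving map *)

Section measure_preserving.
Variable T : X -> X.
Hypothesis T_mp : measure_preserving mu T.

Lemma ae_measure_preserving (P : X -> Prop) :
  {ae mu, forall x, P x} -> {ae mu, forall x, P (T x)}.
Proof.
case: T_mp => mT muT [A [mA A0 PA]]; exists (T @^-1` A); split.
- by rewrite -[_ @^-1` _]setTI; exact: mT.
- by rewrite /= muT.
- by move=> x /= nPx; exact: PA.
Qed.

Lemma Rintegral_measure_preserving f : bounded_measurable f ->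
  (\int[mu]_x f (T x) = \int[mu]_x f x)%R.
Proof.
case: T_mp => mT muT bf; congr fine.
have iT : mu.-integrable (T @^-1` [set: X]) ((EFin \o f) \o T).
  exact: bounded_measurable_integrable (bounded_measurable_comp mT bf).
rewrite -[LHS](integral_pushforward mT _ iT)//; last first.
  by apply/measurable_EFinP; case: bf.
by apply: eq_measure_integral => A mA _; exact: muT.
Qed.

Lemma measurable_iter n : measurable_fun [set: X] (iter n T).
Proof.
case: T_mp => mT _.
by elim: n => [|n IH]; [exact: measurable_id | exact: measurableT_comp].
Qed.

Lemma bounded_measurable_koopman n f : bounded_measurable f ->
  bounded_measurable (koopman T n f).
Proof. exact/bounded_measurable_comp/measurable_iter. Qed.

Lemma koopmanS n f : koopman T n.+1 f = koopman T n f \o T.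
Proof. by apply/funext => x; rewrite /koopman /= -iterS iterSr. Qed.

Lemma inner_measure_preserving f g : bounded_measurable f -> bounded_measurable g ->
  inner (f \o T) (g \o T) = inner f g.
Proof.
move=> bf bg.
exact: (Rintegral_measure_preserving (bounded_measurableM bf bg)).
Qed.

Lemma ae_koopman (P : X -> Prop) n :
  {ae mu, forall x, P x} -> {ae mu, forall x, P (iter n T x)}.
Proof.
move=> aeP; elim: n => [//|n /ae_measure_preserving]; apply: filterS => x.
by rewrite iterSr.
Qed.

Lemma autocorrelation_ae f g n : measurable_fun [set: X] f ->
  measurable_fun [set: X] g -> {ae mu, forall x, f x = g x} ->
  autocorrelation mu T f n = autocorrelation mu T g n.
Proof.
move=> mf mg fg; apply: ae_eq_Rintegral.
- by apply: measurable_funM => //; apply: measurableT_comp => //; exact: measurable_iter.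
- by apply: measurable_funM => //; apply: measurableT_comp => //; exact: measurable_iter.
- by apply: filterS2 (ae_koopman n fg) fg => x; rewrite /koopman /= => -> ->.
Qed.

(** A function equal to [c] almost everywhere has both sides equal to [c * c], so a strict
    inequality at a single time excludes constancy. *)
Lemma not_ae_constant f n : bounded_measurable f ->
  autocorrelation mu T f n != (\int[mu]_x f x)%R ^+ 2 -> ~ ae_constant mu f.
Proof.
move=> [mf _] + [c fc]; have mc := @measurable_cst _ _ X R setT c.
rewrite (autocorrelation_ae n mf mc fc) (ae_eq_Rintegral mf mc fc).
rewrite [X in X != _](Rintegral_probability_cst (c * c)) (Rintegral_probability_cst c).
by rewrite expr2 eqxx.
Qed.

(** * Correlations of the geometric sum *)

Section geometric_series.
Variables (g phi : X -> R) (r : R).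
Hypotheses (r01 : 0 < r < 1) (bg : bounded_measurable g).
Hypotheses (bphi : bounded_measurable phi).
Hypothesis phiE : forall x, phi x = g x + r * phi (T x).
Hypothesis g_orth : forall n, (0 < n)%N -> autocorrelation mu T g n = 0.
Hypothesis g_norm : inner g g = 1.

Let phiF : phi = (fun x => g x + r * (phi \o T) x).
Proof. exact/funext/phiE. Qed.

Let bphiT : bounded_measurable (phi \o T).
Proof. by apply: bounded_measurable_comp => //; case: T_mp. Qed.

Let inner_phi f : bounded_measurable f ->
  inner phi f = inner g f + r * inner (phi \o T) f.
Proof. by move=> bf; rewrite {1}phiF inner_affinel. Qed.

(** Substituting [phiE] repeatedly, each term in [g] vanishes by orthogonality and a factor [r]
    comes out. What is left after [k] substitutions is at most [M * N * r ^+ k] in absolute value,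
    which tends to 0. *)
Lemma inner_koopman_geometric n : (0 < n)%N -> inner g (koopman T n phi) = 0.
Proof.
have [_ [M gM]] := bg; have [_ [N phiN]] := bphi.
have step m : (0 < m)%N ->
    inner g (koopman T m phi) = r * inner g (koopman T m.+1 phi).
  move=> m0; rewrite {1}phiF.
  have -> : koopman T m (fun x => g x + r * (phi \o T) x) =
      (fun x => koopman T m g x + r * koopman T m.+1 phi x) by [].
  rewrite inner_affiner//; try exact: bounded_measurable_koopman.
  by rewrite [X in X + _]g_orth// add0r.
have steps k m : (0 < m)%N ->
    inner g (koopman T m phi) = r ^+ k * inner g (koopman T (m + k) phi).
  elim: k m => [|k IH] m m0; first by rewrite mul1r addn0.
  by rewrite step// IH// mulrA -exprS addSnnS.
have [r0 r1] := andP r01.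
have bound m : `|inner g (koopman T m phi)| <= M * N.
  apply: norm_Rintegral_le => [|x].
    by apply: bounded_measurableM => //; exact: bounded_measurable_koopman.
  by rewrite normrM ler_pM// phiN.
have r_cvg0 : geometric (M * N) r @ \oo --> (0 : R).
  by apply: cvg_geometric; rewrite gtr0_norm.
move=> n0; apply/eqP; rewrite -normr_le0 -(cvg_lim _ r_cvg0)//.
apply: limr_ge; first exact: cvgP r_cvg0.
apply: nearW => k; rewrite (steps k)// normrM normrX gtr0_norm//= mulrC.
by rewrite ler_wpM2r// exprn_ge0// ltW.
Qed.

(** Expanding [phi] on the left, orthogonality removes the term in [g], and invariance cancels one
    [T] on both sides: each time step contributes a factor [r]. *)
Lemma inner_geometric_koopman n : inner phi (koopman T n g) = r ^+ n.
Proof.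
elim: n => [|n IH]; rewrite inner_phi; try exact: bounded_measurable_koopman.
- rewrite [inner g _]g_norm [X in _ * X]innerC.
  by rewrite (inner_koopman_geometric (ltn0Sn 0) : inner g (phi \o T) = 0) mulr0 addr0.
- rewrite [inner g _]g_orth// add0r koopmanS inner_measure_preserving//.
    by rewrite IH exprS.
  exact: bounded_measurable_koopman.
Qed.

Lemma autocorrelation_geometric n :
  autocorrelation mu T phi n = r ^+ n / (1 - r ^+ 2).
Proof.
have [r0 r1] := andP r01; have r2 : 1 - r ^+ 2 != 0 by rewrite gt_eqF//; nra.
have step m : autocorrelation mu T phi m.+1 = r * autocorrelation mu T phi m.
  rewrite /autocorrelation -/(inner _ _) inner_phi; last exact: bounded_measurable_koopman.
  rewrite inner_koopman_geometric// add0r koopmanS inner_measure_preserving//.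
  exact: bounded_measurable_koopman.
elim: n => [|n IH]; last by rewrite step IH mulrA -exprS.
(* Expanding [phi] once gives time 0 in terms of time 1, and [step] leads back to time 0: a linear
   equation for the squared norm. *)
have : autocorrelation mu T phi 0 = 1 + r * (r * autocorrelation mu T phi 0).
  rewrite -step {1}/autocorrelation -/(inner _ _) inner_phi// innerC.
  by rewrite (inner_geometric_koopman 0) [X in _ + r * X]innerC.
move=> c0; apply: (mulIf r2); rewrite expr0 divfK//; lra.
Qed.

Lemma Rintegral_geometric : (\int[mu]_x phi x)%R * (1 - r) = (\int[mu]_x g x)%R.
Proof.
have : (\int[mu]_x phi x = \int[mu]_x g x + r * \int[mu]_x phi x)%R.
  by rewrite {1}phiF Rintegral_affine// Rintegral_measure_preserving.
lra.
Qed.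

End geometric_series.

(* The geometric sums phi_r have mean [m / (1 - r)], where m is the mean of g, and
   squared norm [1 / (1 - r^2)], so [m^2 <= (1 - r) / (1 + r)] for every r < 1. *)
Lemma orthonormal_orbit_mean0 g : bounded_measurable g ->
  (forall n, (0 < n)%N -> autocorrelation mu T g n = 0) -> inner g g = 1 ->
  (\int[mu]_x g x)%R = 0.
Proof.
move=> bg g_orth g_norm; apply/eqP; rewrite -sqrf_eq0; apply/negPn/negP => m0.
have := sqr_Rintegral_le bg; rewrite -/(inner g g) g_norm.
set m := (\int[mu]_x g x)%R in m0 *; move=> m1.
have {}m0 : 0 < m ^+ 2 by rewrite lt_neqAle eq_sym m0 sqr_ge0.
(* Since [m ^+ 2 <= 1], this [r] is at least 1/2. As [1 - r] is half of [m ^+ 2], the bound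
   [m ^+ 2 * (1 + r) <= 1 - r] would force [1 + r <= 1/2]. *)
pose r := 1 - m ^+ 2 / 2.
have r01 : 0 < r < 1 by rewrite /r; apply/andP; split; lra.
have [mT _] := T_mp.
have [phi [bphi phiE]] := bounded_measurable_geometric mT r01 bg.
have := sqr_Rintegral_le bphi.
rewrite -[(\int[mu]_x (phi x * phi x))%R]/(autocorrelation mu T phi 0).
rewrite (autocorrelation_geometric r01 bg bphi phiE)//.
have := Rintegral_geometric bg bphi phiE; rewrite -/m expr0.
have [r0 r1] := andP r01; have r2 : 0 < 1 - r ^+ 2 by nra.
set a := (\int[mu]_x phi x)%R => am; rewrite ler_pdivlMr// => a_le.
(* Multiply [a ^+ 2 * (1 - r ^+ 2) <= 1] by [1 - r], so that the mean [m = a * (1 - r)] appears. *)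
have : (a * (1 - r)) ^+ 2 * (1 + r) <= 1 - r.
  rewrite (_ : _ * _ = a ^+ 2 * (1 - r ^+ 2) * (1 - r)); last by ring.
  by rewrite ler_piMl// subr_ge0 ltW.
rewrite am /r in r0 r1 *; nra.
Qed.


End measure_preserving.
End inner_product.

(** * Rescaling to [0,1], and truncation of the given function *)

Section rescaling.
Context {d : measure_display} {X : measurableType d} {R : realType}.
Variables (mu : probability X R) (T : X -> X).
Hypothesis T_mp : measure_preserving mu T.

(** For [f = 1/2 + c * phi] the cross terms vanish because [phi] and its iterates have mean zero.
    The factor [a = c ^+ 2] is positive, so the sign of each autocorrelation of [phi] decides the
    comparison for [f]. *)
Lemma rescale_to_unit_interval (phi : X -> R) : bounded_measurable phi ->
  (\int[mu]_x phi x)%R = 0 ->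
  exists a : R, exists f : X -> R, [/\ 0 < a, bounded_measurable f,
    forall x, 0 <= f x <= 1 & forall n,
    autocorrelation mu T f n = (\int[mu]_x f x)%R ^+ 2 + a * autocorrelation mu T phi n].
Proof.
move=> bphi phi0; have [_ [M phiM]] := bphi.
(* Chosen so that [|c * phi x| <= 1/2]; the summand 1 keeps the denominator nonzero. *)
pose c : R := (2 * (1 + `|M|))^-1.
have M0 : 0 < 2 * (1 + `|M|) by rewrite mulr_gt0// ltr_pwDl.
have c0 : 0 < c by rewrite invr_gt0.
have b2 := bounded_measurable_cst (X := X) (2^-1 : R).
have bf : bounded_measurable (fun x => 2^-1 + c * phi x).
  exact/bounded_measurableD/bounded_measurableZ.
exists (c ^+ 2), (fun x => 2^-1 + c * phi x); split => //; first exact: exprn_gt0.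
  move=> x; have : `|c * phi x| <= 2^-1.
    rewrite normrM gtr0_norm// /c invfM -mulrA ler_piMr ?invr_ge0//.
    rewrite mulrC ler_pdivrMr ?mul1r ?ltr_pwDl//.
    by rewrite (le_trans (phiM x))// (le_trans (ler_norm M))// lerDr.
  by rewrite ler_norml => /andP[? ?]; apply/andP; split; lra.
move=> n; have bk := bounded_measurable_koopman T_mp n bphi.
rewrite Rintegral_affine// phi0 mulr0 addr0 Rintegral_probability_cst.
rewrite /autocorrelation -/(inner _ _ _).
have -> : koopman T n (fun x => 2^-1 + c * phi x) =
  (fun x => 2^-1 + c * koopman T n phi x) by [].
rewrite inner_affinel//; last exact/bounded_measurableD/bounded_measurableZ.
rewrite !inner_affiner//.
have koopman0 : (\int[mu]_x koopman T n phi x)%R = 0.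
  elim: n {bk} => [//|n IH].
  have bk := bounded_measurable_koopman T_mp n bphi.
  by rewrite koopmanS (Rintegral_measure_preserving T_mp bk).
have innerl h : bounded_measurable h -> inner mu (fun=> 2^-1) h = 2^-1 * (\int[mu]_x h x)%R.
  by move=> bh; rewrite -RintegralZl//; exact: bounded_measurable_integrable.
rewrite (innerC _ phi) !innerl// phi0 koopman0 Rintegral_probability_cst.
rewrite -/(inner mu phi _); ring.
Qed.

End rescaling.

(** Truncation changes [g] only on a null set, whose preimages under the iterates of [T] are null,
    so every autocorrelation is kept. *)
Lemma Lebesgue_spectral_measure_bounded (d : measure_display)
    (X : measurableType d) (R : realType) (mu : probability X R) (T : X -> X) :
  measure_preserving mu T -> bounded_Lebesgue_spectral_measure mu T ->
  exists g : X -> R, [/\ bounded_measurable g, inner mu g g = 1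
    & forall n, (0 < n)%N -> autocorrelation mu T g n = 0].
Proof.
move=> T_mp [g [gLoo g_norm g_orth]].
have mg : measurable_fun [set: X] g by move: gLoo; rewrite inE => /andP[]; rewrite inE.
have [h [bh gh]] := essentially_bounded_clip gLoo; exists h.
have auto_gh n : autocorrelation mu T g n = autocorrelation mu T h n.
  by apply: autocorrelation_ae => //; case: bh.
split => // [|n n0]; last by rewrite -auto_gh g_orth.
(* The norm is transferred as the autocorrelation at time 0, which is the square of the [Lnorm] of
   [g]. *)
rewrite -[LHS](auto_gh 0).
have := powR_Lnorm mu (EFin \o g) (r := 2).
rewrite g_norm -[1%E]/(1%:E) poweR_EFin powR1 pnatr_eq0 => /(_ isT) int_sqr.
rewrite /autocorrelation /Rintegral -[RHS]/(fine 1%:E) int_sqr; congr fine.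
apply: eq_integral => x _ /=.
by rewrite powR_mulrn// real_normK ?num_real// expr2.
Qed.

(** * Construction of the two recurrent functions *)

Theorem theorem2p7 (R : realType) (d : measure_display) (X : measurableType d)
    (mu : probability X R) (T : X -> X) :
  measure_preserving mu T ->
  bounded_Lebesgue_spectral_measure mu T ->
  (exists f : X -> R,
     (forall x : X, 0 <= f x <= 1) /\ strictly_under_recurrent mu T f) /\
  (exists f : X -> R,
     (forall x : X, 0 <= f x <= 1) /\ strictly_over_recurrent mu T f).
Proof.
move=> T_mp /(Lebesgue_spectral_measure_bounded T_mp) [g [bg g_norm g_orth]].
have [mT _] := T_mp.
(* Under-recurrence of [phi - 2 g] requires [1 / (1 - r ^+ 2) < 2], that is [r ^+ 2 < 1/2]; the
   value 1/2 satisfies this. *)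
have half01 : 0 < (2^-1 : R) < 1 by apply/andP; split; lra.
have [phi [bphi phiE]] := bounded_measurable_geometric mT half01 bg.
have g0 := orthonormal_orbit_mean0 T_mp bg g_orth g_norm.
have phi0 : (\int[mu]_x phi x)%R = 0.
  by have := Rintegral_geometric T_mp bg bphi phiE; rewrite g0; lra.
have auto_phi := autocorrelation_geometric T_mp half01 bg bphi phiE g_orth g_norm.
have pow_gt0 n : 0 < (2^-1 : R) ^+ n by rewrite exprn_gt0.
split.
- pose psi x := phi x + -2 * g x.
  have bpsi : bounded_measurable psi by exact/bounded_measurableD/bounded_measurableZ.
  have psi0 : (\int[mu]_x psi x)%R = 0 by rewrite Rintegral_affine// phi0 g0; ring.
  have [a [f [a0 bf f01 auto_f]]] := rescale_to_unit_interval T_mp bpsi psi0.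
  have under n : (0 < n)%N -> autocorrelation mu T f n < (\int[mu]_x f x)%R ^+ 2.
    move=> n0; rewrite auto_f gtrDl pmulr_rlt0//.
    have bphin := bounded_measurable_koopman T_mp n bphi.
    have bgn := bounded_measurable_koopman T_mp n bg.
    have -> : autocorrelation mu T psi n =
        inner mu psi (fun x => koopman T n phi x + -2 * koopman T n g x) by [].
    rewrite inner_affiner// !inner_affinel//.
    rewrite -[inner mu g (koopman T n g)]/(autocorrelation mu T g n) g_orth//.
    rewrite (inner_koopman_geometric T_mp half01 bg bphi phiE g_orth n0).
    rewrite (inner_geometric_koopman T_mp half01 bg bphi phiE g_orth g_norm).
    rewrite -[inner mu phi (koopman T n phi)]/(autocorrelation mu T phi n) auto_phi.
    (* Two of the four terms vanish; the others give [4/3 - 2] times the power of 1/2. *)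
    rewrite (_ : _ + _ = - (2 / 3) * 2^-1 ^+ n); last by field.
    by rewrite nmulr_rlt0// oppr_lt0 divr_gt0.
  exists f; split=> //; split=> //; first exact: bounded_measurable_Lfun2.
  by apply: (not_ae_constant T_mp (n := 1)) => //; rewrite lt_eqF// under.
- have [a [f [a0 bf f01 auto_f]]] := rescale_to_unit_interval T_mp bphi phi0.
  have over n : (0 < n)%N -> autocorrelation mu T f n > (\int[mu]_x f x)%R ^+ 2.
    move=> _; rewrite auto_f ltrDl mulr_gt0// auto_phi divr_gt0//; lra.
  exists f; split=> //; split=> //; first exact: bounded_measurable_Lfun2.
  by apply: (not_ae_constant T_mp (n := 1)) => //; rewrite gt_eqF// over.
Qed.
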